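(* Let $\alpha>0$, $\beta>0$, $n\ge0$ an integer. The function $Y_n$ defined by $Y_n(-\lambda)=1-\lambda/R_n(\lambda)$, $\lambda\in\mathbb{R}$, satisfies, for real $\lambda\neq0$, the Painlevé V equation $P_{\rm V}\left(\frac{\alpha^2}{2},-\frac{\beta^2}{2},2n+1+\alpha+\beta,-\frac12\right)$, namely $$Y_n''=\frac{3Y_n-1}{2Y_n(Y_n-1)}(Y_n')^2-\frac{Y_n'}{\lambda}+\frac{(Y_n-1)^2}{\lambda^2}\left(\frac{\alpha^2}{2}Y_n-\frac{\beta^2/2}{Y_n}\right)+(2n+1+\alpha+\beta)\frac{Y_n}{\lambda}-\frac12\frac{Y_n(Y_n+1)}{Y_n-1},$$ where $Y_n=Y_n(\lambda)$ and $'=d/d\lambda$, with initial conditions $$Y_n(0)=1,\qquad Y_n'(0)=\frac{1}{2n+1+\alpha+\beta}.$$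
   Context: $w(x)=x^{\alpha}(1-x)^{\beta}e^{-\lambda x}$ on $[0,1]$; $P_n$ is the monic orthogonal polynomial of degree $n$ for $w$ on $[0,1]$ (depending on $\lambda$), $h_n=\int_0^1P_n^2w\,dx$, and $$R_n(\lambda)=\frac{\alpha}{h_n}\int_0^1\frac{P_n^2(y)}{y}\,y^{\alpha}(1-y)^{\beta}e^{-\lambda y}\,dy .$$ $P_{\rm V}(a,b,c,d)$ denotes the equation $Y''=\frac{3Y-1}{2Y(Y-1)}(Y')^2-\frac{Y'}{\lambda}+\frac{(Y-1)^2}{\lambda^2}\left(aY+\frac bY\right)+\frac{cY}{\lambda}+\frac{dY(Y+1)}{Y-1}$. *)

(* Defs.v *)
From HB Require Import structures.
From mathcomp Require Import all_boot all_order all_algebra.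
From mathcomp Require Import all_classical all_reals all_analysis.
Set Implicit Arguments.
Unset Strict Implicit.
Unset Printing Implicit Defensive.
Import Order.TTheory GRing.Theory Num.Theory.
Import numFieldNormedType.Exports.
Local Open Scope classical_set_scope.
Local Open Scope ring_scope.

Section Definitions.
Variable R : realType.
Implicit Types (a b c d l x t : R) (f w Y : R -> R) (p : {poly R}).

(* Lebesgue integral over [0, 1]: when 0 < a < 1 the integrand defining [R_coef]
   is unbounded near 0, so a proper Riemann integral would not do. *)
Definition int01 f : R := \int[lebesgue_measure]_(x in `[0, 1]) f x.

Definition weight a b l x : R := x `^ a * (1 - x) `^ b * expR (- (l * x)).

Definition monic_orthogonal w (P : nat -> {poly R}) : Prop :=
  (forall k, P k \is monic /\ size (P k) = k.+1) /\
  (forall j k, j != k -> int01 (fun x => (P j).[x] * (P k).[x] * w x) = 0).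

Definition sq_norm w p : R := int01 (fun x => p.[x] ^+ 2 * w x).

(* The value of the integrand at y = 0, where [0^-1 = 0] by convention, is
   irrelevant since a point has measure zero. *)
Definition R_coef a b l p : R :=
  a / sq_norm (weight a b l) p *
  int01 (fun y => p.[y] ^+ 2 / y * weight a b l y).

(* [Y] solves P_V(a, b, c, d) at the point [t]. Division being total, the
   equation is only meaningful where no denominator vanishes, hence the
   requirement that [t], [Y t] and [Y t - 1] be nonzero. *)
Definition painleve5_at a b c d Y t : Prop :=
  [/\ [/\ t != 0, Y t != 0 & Y t != 1],
      derivable Y t 1, derivable (derive1 Y) t 1 &
      derive1 (derive1 Y) t =
        (3 * Y t - 1) / (2 * Y t * (Y t - 1)) * derive1 Y t ^+ 2
        - derive1 Y t / t
        + (Y t - 1) ^+ 2 / t ^+ 2 * (a * Y t + b / Y t)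
        + c * Y t / t
        + d * Y t * (Y t + 1) / (Y t - 1)].

End Definitions.

(* Main.v *)
Require Import Defs.
From HB Require Import structures.
From mathcomp Require Import all_boot all_order all_algebra.
From mathcomp Require Import all_classical all_reals all_analysis.
From mathcomp Require Import measurable_realfun lebesgue_integral_under ring lra.
Set Implicit Arguments.
Unset Strict Implicit.
Unset Printing Implicit Defensive.
Import Order.TTheory GRing.Theory Num.Theory.
Import numFieldNormedType.Exports.
Local Open Scope classical_set_scope.
Local Open Scope ring_scope.

(** All the integrals involved have the form
    J_l(p) = int_0^1 p(x) x^(alpha-1) (1-x)^(beta-1) e^(-l x) dx with p a
    polynomial, and only three properties of J_l matter: it is positive, its
    derivative in l is - J_l(x p), and it satisfies the identity coming from
    integrating the derivative of p(x) x^alpha (1-x)^beta e^(-l x), which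
    vanishes at both ends.  For n > 0 put rho_n = R_n(l), b = h_n / h_(n-1) and
    r = (alpha / h_(n-1)) int P_n P_(n-1) w / x.  Orthogonality then gives
      rho_n' = 2 r - alpha + a rho_n,  l a = 2 n + 1 + alpha + beta + l - rho_n,
      r' = b (rho_(n-1) - rho_n),
      b rho_n rho_(n-1) = r (r - alpha),
      b (rho_n - l) (rho_(n-1) - l) = (r + n) (r + n + beta).
    The last two relations determine b and rho_(n-1) from rho_n and r, which
    leaves a first order system for (rho_n, r); eliminating r yields Painleve V
    for 1 - l / rho_n.  Moreover rho_n and rho_n - l are positive, being alpha
    and beta times normalized integrals of P_n^2 w / x and P_n^2 w / (1 - x), so
    that the unknown function avoids 0, and avoids 1 when l != 0. *)

(** * Orthogonal polynomials for a linear functional *)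

(** Multiplication of the integrand by a fixed polynomial, named so that it carries its own linear
    structure. *)
Definition mul_functional (F : fieldType) (L : {scalar {poly F}}) (q p : {poly F}) : F :=
  L (q * p).

Fact mul_functional_is_scalar (F : fieldType) (L : {scalar {poly F}}) q :
  scalar (mul_functional L q).
Proof. by move=> a u v; rewrite /mul_functional mulrDr -scalerAr linearP. Qed.

HB.instance Definition _ (F : fieldType) (L : {scalar {poly F}}) q :=
  GRing.isLinear.Build F {poly F} F^o *%R (mul_functional L q)
    (mul_functional_is_scalar L q).

Lemma functionalZ (F : fieldType) (K : {scalar {poly F}}) a p :
  K (a *: p) = a * K p.
Proof. exact: linearZ. Qed.

Lemma functionalD (F : fieldType) (K : {scalar {poly F}}) p q :
  K (p + q) = K p + K q.
Proof. exact: linearD. Qed.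

Lemma functionalB (F : fieldType) (K : {scalar {poly F}}) p q :
  K (p - q) = K p - K q.
Proof. exact: linearB. Qed.

Section MonicBasis.
Variables (F : fieldType) (P : nat -> {poly F}).
Implicit Types (q D : {poly F}).
Hypothesis P_monic : forall k, P k \is monic.
Hypothesis P_size : forall k, size (P k) = k.+1.

Lemma coef_monic_basis k : (P k)`_k = 1.
Proof. by have /monicP := P_monic k; rewrite lead_coefE P_size. Qed.

Lemma size_sub_monic_basis n (q : {poly F}) :
  (size q <= n.+1)%N -> (size (q - q`_n *: P n)%R <= n)%N.
Proof.
move=> sq; apply/leq_sizeP => j; rewrite leq_eqVlt => /predU1P[<-|nj].
  by rewrite coefB coefZ coef_monic_basis mulr1 subrr.
rewrite coefB coefZ [q`_j]nth_default ?(leq_trans sq) //.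
by rewrite [(P n)`_j]nth_default ?P_size // mulr0 subrr.
Qed.

(** Subtracting the multiple of [P n] with the same top coefficient lowers the degree, so the [P k]
    with [k < n] span the polynomials of size at most [n]. *)
Lemma functional_eq0_span (K : {scalar {poly F}}) n q :
  (forall k, (k < n)%N -> K (P k) = 0) -> (size q <= n)%N -> K q = 0.
Proof.
move=> KP; elim: n => [|n IH] in q KP *.
  by rewrite leqn0 size_poly_eq0 => /eqP ->; rewrite linear0.
move=> sq; rewrite -(subrK (q`_n *: P n) q) linearD /=
  functionalZ KP // mulr0 addr0.
by apply: IH; [move=> k kn; apply: KP; exact: ltnW | exact: size_sub_monic_basis].
Qed.

Variable L : {scalar {poly F}}.
Hypothesis orth : forall j k, j != k -> L (P j * P k) = 0.

Lemma orth_low n q : (size q <= n)%N -> L (P n * q) = 0.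
Proof.
apply: (@functional_eq0_span (mul_functional L (P n))) => k kn.
by rewrite /= /mul_functional orth // gtn_eqF.
Qed.

Lemma orth_coef n q : (size q <= n.+1)%N ->
  L (P n * q) = q`_n * L (P n * P n).
Proof.
move=> sq; rewrite -{1}(subrK (q`_n *: P n) q) mulrDr linearD /= orth_low; last first.
  exact: size_sub_monic_basis.
by rewrite add0r -scalerAr functionalZ.
Qed.

Hypothesis L_neq0 : forall p : {poly F}, p != 0 -> L (p * p) != 0.

(** Such a [D] is a combination of the [P k] with [k < n], hence [L (D * D)] is 0. Polynomial
    identities are later proved by testing against the [P k]. *)
Lemma orth_eq0 n D : (size D <= n)%N ->
  (forall k, (k < n)%N -> L (D * P k) = 0) -> D = 0.
Proof.
move=> sD DP; apply/eqP; apply: contraT => /L_neq0/negP[].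
exact/eqP/(functional_eq0_span (K := mul_functional L D) DP sD).
Qed.

Lemma orth_expansion n q : (size q <= n)%N ->
  q = \sum_(k < n) (L (q * P k) / L (P k * P k)) *: P k.
Proof.
move=> sq; apply/eqP; rewrite -subr_eq0; apply/eqP; apply: (@orth_eq0 n).
  rewrite (leq_trans (size_polyD _ _)) // geq_max sq size_polyN.
  apply: (leq_trans (size_sum _ _ _)); apply/bigmax_leqP => i _.
  by rewrite (leq_trans (size_scale_leq _ _)) // P_size.
move=> j jn; rewrite mulrBl linearB /= mulr_suml linear_sum /=.
rewrite (bigD1 (Ordinal jn)) //= -scalerAl functionalZ divfK; last first.
  by apply: L_neq0; rewrite -size_poly_gt0 P_size.
rewrite big1 ?addr0 ?subrr // => i ij.
by rewrite -scalerAl functionalZ [L (P i * P j)]orth ?mulr0 //; exact: ij.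
Qed.

Variables (c : F) (M : {scalar {poly F}}).
Hypothesis ML : forall p, M (('X - c%:P) * p) = L p.

(** [M] stands for [L] with the extra factor 1/(x - c). Divide [q] by X - c: the remainder [q.[c]]
    gives the first term; of the quotient only the coefficient of degree n, which is that of [q] in
    degree n + 1, survives orthogonality. *)
Lemma functional_pole n q : (size q <= n.+2)%N ->
  M (P n * q) = q.[c] * M (P n) + q`_n.+1 * L (P n * P n).
Proof.
move=> sq.
have /factor_theorem[s qE] : root (q - q.[c]%:P) c.
  by rewrite /root !hornerE subrr.
have ss : (size s <= n.+1)%N.
  have [->|s0] := eqVneq s 0; first by rewrite size_poly0.
  rewrite -ltnS; have <- : size (s * ('X - c%:P)) = (size s).+1.
    by rewrite size_Mmonic ?monicXsubC // size_XsubC addn2.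
  rewrite -qE (leq_trans (size_polyD _ _)) // geq_max sq size_polyN.
  by rewrite (leq_trans (size_polyC_leq1 _)).
rewrite (_ : P n * q = q.[c] *: P n + ('X - c%:P) * (P n * s)); last first.
  by rewrite -[in LHS](subrK q.[c]%:P q) qE -mul_polyC; ring.
rewrite linearD /= functionalZ ML orth_coef //; congr (_ + _ * _).
rewrite -[q](subrK q.[c]%:P) qE coefD coefC addr0 mulrBr coefB coefMX coefMC /=.
by rewrite [in X in _ - X]nth_default // mul0r subr0.
Qed.

(** The mixed value m can be expanded with either factor as [q]: m = P_n(c) M(P_(n+1)) and m - h_n =
    P_(n+1)(c) M(P_n). Since M(P_k^2) = P_k(c) M(P_k), both sides are the same product of four
    factors. *)
Lemma functional_pole_prod n (m := M (P n * P n.+1)) :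
  M (P n.+1 * P n.+1) * M (P n * P n) = m * (m - L (P n * P n)).
Proof.
have K := functional_pole.
have sP k : (k <= n.+1)%N -> (size (P k) <= n.+2)%N by rewrite P_size ltnS.
have m1 : m = (P n).[c] * M (P n.+1).
  rewrite /m mulrC K ?(leqW (sP _ _)) //.
  by rewrite [(P n)`__]nth_default ?P_size // mul0r addr0.
have m2 : m - L (P n * P n) = (P n.+1).[c] * M (P n).
  by rewrite /m K ?sP // coef_monic_basis mul1r addrK.
rewrite m2 m1 !K ?sP ?(leqW (sP _ _)) //.
rewrite [(P n)`__]nth_default ?[(P n.+1)`__]nth_default ?P_size //.
by rewrite !mul0r !addr0; ring.
Qed.

End MonicBasis.

(** * Families of polynomials depending on a parameter *)

Lemma is_derive1_mul (R : realType) (f g : R -> R) (x df dg : R) :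
  is_derive x 1 f df -> is_derive x 1 g dg ->
  is_derive x 1 (fun y => f y * g y) (df * g x + f x * dg).
Proof.
move=> fx gx; apply: is_derive_eq (is_deriveM fx gx) _.
by rewrite addrC mulrC [X in _ + X](mulrC).
Qed.

Lemma is_derive1_div (R : realType) (f g : R -> R) (x df dg : R) : g x != 0 ->
  is_derive x 1 f df -> is_derive x 1 g dg ->
  is_derive x 1 (fun y => f y / g y) (df / g x - f x * dg / g x ^+ 2).
Proof.
move=> gx0 fx gx.
have ix : is_derive x 1 (fun y => (g y)^-1) (- (g x) ^- 2 * dg).
  apply: DeriveDef; first by apply: derivableV => //; exact: ex_derive.
  by rewrite deriveV ?derive_val.
apply: is_derive_eq (is_derive1_mul fx ix) _.
by rewrite mulNr mulrN mulrA [f x / _]mulrC -!mulrA [_^-1 * _]mulrC mulrA.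
Qed.

Lemma is_derive1_sum (R : realType) n (h : 'I_n -> R -> R) (x : R) (dh : 'I_n -> R) :
  (forall i, is_derive x 1 (h i) (dh i)) ->
  is_derive x 1 (fun y => \sum_(i < n) h i y) (\sum_(i < n) dh i).
Proof.
move=> hx; have := is_derive_sum hx.
by rewrite (_ : \sum_(i < n) h i = fun y => \sum_(i < n) h i y) // funeqE => y;
  rewrite fct_sumE.
Qed.

Lemma is_derive1_unique (R : realType) (f : R -> R) (x a b : R) :
  is_derive x 1 f a -> is_derive x 1 f b -> a = b.
Proof. by move=> fa fb; rewrite -(derive_val (is_derive := fa)) derive_val. Qed.

Section PolyFamily.
Variable R : realType.
Implicit Types (p q : R -> {poly R}) (x : R).

(** Derivatives are taken coefficient by coefficient; a uniform degree bound is supplied separately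
    where it matters. *)
Definition is_derive_coef x p (dp : {poly R}) : Prop :=
  forall i, is_derive x 1 (fun y => (p y)`_i) dp`_i.

Lemma is_derive_coef_cst x (c : {poly R}) : is_derive_coef x (fun=> c) 0.
Proof. by move=> i; rewrite coef0; exact: is_derive_cst. Qed.

Lemma is_derive_coefB x p q dp dq : is_derive_coef x p dp ->
  is_derive_coef x q dq -> is_derive_coef x (fun y => p y - q y) (dp - dq).
Proof.
move=> px qx i; rewrite coefB.
under [X in is_derive _ _ X _]funext do rewrite coefB.
exact: is_deriveB.
Qed.

Lemma is_derive_coefM x p q dp dq : is_derive_coef x p dp ->
  is_derive_coef x q dq ->
  is_derive_coef x (fun y => p y * q y) (dp * q x + p x * dq).
Proof.
move=> px qx i; rewrite coefD !coefM -big_split /=.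
under [X in is_derive _ _ X _]funext do rewrite coefM.
by apply: is_derive1_sum => j; exact: is_derive1_mul.
Qed.

Lemma is_derive_coefZ x (c : R -> R) p dc dp : is_derive x 1 c dc ->
  is_derive_coef x p dp ->
  is_derive_coef x (fun y => c y *: p y) (dc *: p x + c x *: dp).
Proof.
move=> cx px i; rewrite coefD !coefZ.
under [X in is_derive _ _ X _]funext do rewrite coefZ.
exact: is_derive1_mul.
Qed.

Lemma is_derive_coef_sum x n (p : 'I_n -> R -> {poly R}) (dp : 'I_n -> {poly R}) :
  (forall k, is_derive_coef x (p k) (dp k)) ->
  is_derive_coef x (fun y => \sum_(k < n) p k y) (\sum_(k < n) dp k).
Proof.
move=> px i; rewrite coef_sum.
under [X in is_derive _ _ X _]funext do rewrite coef_sum.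
by apply: is_derive1_sum => k; exact: px.
Qed.

(** Coefficients that do not vary have derivative 0. For monic polynomials of degree n this applies
    with [N = n], so the derivative has lower degree. *)
Lemma size_is_derive_coef x p dp N c :
  (forall y i, (N <= i)%N -> (p y)`_i = c i) -> is_derive_coef x p dp ->
  (size dp <= N)%N.
Proof.
move=> pN px; apply/leq_sizeP => i Ni.
apply: (is_derive1_unique (px i)).
under [X in is_derive _ _ X _]funext do rewrite pN //.
exact: is_derive_cst.
Qed.

Variable J : R -> {scalar {poly R}}.
Hypothesis dJ : forall x (p : {poly R}),
  is_derive x 1 (fun y => J y p) (- J x ('X * p)).

(** The uniform bound [N] turns the value into a fixed finite sum of coefficients times moments, to
    which the product rule applies. *)
Lemma is_derive_functional x p dp N : (forall y, (size (p y) <= N)%N) ->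
  is_derive_coef x p dp ->
  is_derive x 1 (fun y => J y (p y)) (J x dp - J x ('X * p x)).
Proof.
move=> sp px.
have sdp : (size dp <= N)%N.
  by apply: size_is_derive_coef px => y i Ni; exact/nth_default/(leq_trans (sp y)).
have expand (q : {poly R}) : (size q <= N)%N -> q = \sum_(i < N) q`_i *: 'X^i.
  move=> sq; rewrite -[LHS](coefK q) poly_def (big_ord_widen N (fun i => q`_i *: 'X^i)) //.
  rewrite big_mkcond; apply: eq_bigr => i _; case: ifPn => //.
  by rewrite -leqNgt => /(nth_default 0) ->; rewrite scale0r.
have JE y : J y (p y) = \sum_(i < N) (p y)`_i * J y 'X^i.
  rewrite {1}(expand _ (sp y)) linear_sum /=.
  by apply: eq_bigr => i _; rewrite functionalZ.
under [X in is_derive _ _ X _]funext do rewrite JE.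
rewrite {1}(expand _ sdp) [in 'X * p x](expand _ (sp x)) mulr_sumr !linear_sum /=.
rewrite -big_split /=.
under eq_bigr do rewrite -scalerAr !functionalZ -mulrN.
by apply: is_derive1_sum => i; exact: is_derive1_mul.
Qed.

End PolyFamily.

(** * The ladder system *)

(** Divides the product formula at a pole by the norms; [c] will be [alpha] at the pole 0 and [beta]
    at the pole 1. *)
Lemma pole_prod_normalized (F : fieldType) (c x y m h h' : F) :
  h != 0 -> h' != 0 -> x * y = m * (m - h) ->
  h' / h * (c * x / h') * (c * y / h) = c * m / h * (c * m / h - c).
Proof.
move=> h0 h'0 E; transitivity (c ^+ 2 * (x * y) / h ^+ 2).
  by field; rewrite h0 h'0.
by rewrite E; field.
Qed.

Section Ladder.
Variables (R : realType) (alpha beta : R) (J : R -> {scalar {poly R}}).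
Variable P : R -> nat -> {poly R}.
Implicit Types (l : R) (n : nat) (p q : {poly R}).

Hypothesis dJ : forall l p, is_derive l 1 (fun y => J y p) (- J l ('X * p)).
Hypothesis J_gt0 : forall l p, p != 0 ->
  (forall x, 0 <= x <= 1 -> 0 <= p.[x]) -> 0 < J l p.
Hypothesis J_parts : forall l p,
  J l ('X * (1 - 'X) * p^`()) + alpha * J l ((1 - 'X) * p)
  - beta * J l ('X * p) - l * J l ('X * (1 - 'X) * p) = 0.

(* [M0 l p] and [M1 l p] stand for [L l (p / 'X)] and [L l (p / ('X - 1))]. *)
Let L l : {scalar {poly R}} := mul_functional (J l) ('X * (1 - 'X)).
Let M0 l : {scalar {poly R}} := mul_functional (J l) (1 - 'X).
Let M1 l : {scalar {poly R}} := mul_functional (J l) (- 'X).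

Hypothesis P_monic : forall l k, P l k \is monic.
Hypothesis P_size : forall l k, size (P l k) = k.+1.
Hypothesis P_orth : forall l j k, j != k ->
  J l ('X * (1 - 'X) * (P l j * P l k)) = 0.

Let L_orth l j k : j != k -> L l (P l j * P l k) = 0.
Proof. exact: P_orth. Qed.

Let M0L l p : M0 l (('X - 0%:P) * p) = L l p.
Proof. by rewrite /M0 /L /= /mul_functional subr0 mulrA [_ * 'X]mulrC. Qed.

Let M1L l p : M1 l (('X - 1%:P) * p) = L l p.
Proof.
by rewrite /M1 /L /= /mul_functional mulrA mulNr -mulrN opprB.
Qed.

(** The logarithmic derivative of the weight is alpha/x + beta/(x - 1) - l, and its three terms
    correspond to [M0], [M1] and [L]. *)
Let parts l p : L l p^`() + alpha * M0 l p + beta * M1 l p - l * L l p = 0.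
Proof.
rewrite -[RHS](J_parts l p) /L /M0 /M1 /= /mul_functional.
by rewrite mulNr linearN mulrN.
Qed.

Let X_neq0 : 'X != 0 :> {poly R}. Proof. by rewrite polyX_eq0. Qed.
Let onemX_neq0 : 1 - 'X != 0 :> {poly R}.
Proof. by rewrite subr_eq0 eq_sym -subr_eq0 -polyC1 polyXsubC_eq0. Qed.

Let L_gt0 l p : p != 0 -> 0 < L l (p * p).
Proof.
move=> p0; apply: J_gt0; first by rewrite !mulf_neq0.
move=> x /andP[x0 x1]; rewrite !hornerE /=.
by rewrite -mulrA -expr2 mulr_ge0 ?sqr_ge0 ?mulr_ge0 ?subr_ge0.
Qed.

Let M0_gt0 l p : p != 0 -> 0 < M0 l (p * p).
Proof.
move=> p0; apply: J_gt0; first by rewrite !mulf_neq0.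
move=> x /andP[x0 x1]; rewrite !hornerE /=.
by rewrite -mulrA -expr2 mulr_ge0 ?subr_ge0 ?sqr_ge0.
Qed.

Let M1_lt0 l p : p != 0 -> M1 l (p * p) < 0.
Proof.
move=> p0; rewrite /M1 /= /mul_functional mulNr linearN oppr_lt0.
apply: J_gt0; first by rewrite !mulf_neq0.
by move=> x /andP[x0 x1]; rewrite !hornerE /= -mulrA -expr2 mulr_ge0 ?sqr_ge0.
Qed.

Let L_neq0 l p : p != 0 -> L l (p * p) != 0.
Proof. by move=> p0; rewrite gt_eqF ?L_gt0. Qed.

Let P_neq0 l n : P l n != 0.
Proof. by rewrite -size_poly_gt0 P_size. Qed.

(** * Norms and normalized integrals: algebraic relations *)

Let h n l := L l (P l n * P l n).

Let h_gt0 n l : 0 < h n l. Proof. exact: L_gt0. Qed.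
Let h_neq0 n l : h n l != 0. Proof. exact: L_neq0. Qed.

Let low l n q : (size q <= n)%N -> L l (P l n * q) = 0.
Proof. exact: (orth_low (P_monic l) (P_size l) (@L_orth l)). Qed.

Let top l n q : (size q <= n.+1)%N -> L l (P l n * q) = q`_n * h n l.
Proof. exact: (orth_coef (P_monic l) (P_size l) (@L_orth l)). Qed.

Let P_eq0 l n q : (size q <= n)%N ->
  (forall k, (k < n)%N -> L l (q * P l k) = 0) -> q = 0.
Proof. exact: (orth_eq0 (P_monic l) (P_size l) (@L_neq0 l)). Qed.

Let coefP l k : (P l k)`_k = 1.
Proof. exact: coef_monic_basis (P_monic l) (P_size l) k. Qed.

(** [a] is the diagonal coefficient of the three-term recurrence, and [rho] is R_n expressed through
    the functionals. *)
Let a n l := L l ('X * (P l n * P l n)) / h n l.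
Let rho n l := alpha * M0 l (P l n * P l n) / h n l.
Let kappa n := 2 * n%:R + 1 + alpha + beta.

Let size_derivP l n : (size (P l n)^`() <= n)%N.
Proof. by rewrite -ltnS -(P_size l n) lt_size_deriv. Qed.

(** Integration by parts with p = P_n^2, whose derivative 2 P_n P_n' is killed by orthogonality.
    Since 1/(x - 1) is negative inside the interval, this gives the sign of R_n - l. *)
Let rhoBl n l : rho n l - l = - (beta * M1 l (P l n * P l n)) / h n l.
Proof.
have := parts l (P l n * P l n).
rewrite derivM linearD /= [_^`() * _]mulrC low ?size_derivP //.
rewrite -/(h n l) => E; apply/(mulIf (h_neq0 n l)).
by rewrite /rho mulrBl !mulfVK //; move: E; lra.
Qed.

(** Integration by parts with p = x P_n^2. The derivative term is (2 n + 1) h_n, because x P_n' has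
    top coefficient n; the factor x cancels the pole at 0 and is split as (x - 1) + 1 at the
    other. *)
Let rho_a n l : l * a n l = kappa n + l - rho n l.
Proof.
have := parts l ('X * (P l n * P l n)).
rewrite -[in M0 l _](subr0 'X) -polyC0 M0L -[in M1 l _](subrK 1%:P 'X) mulrDl.
rewrite linearD /= M1L mul1r !derivM derivX mul1r.
rewrite (_ : _ + _ = P l n * P l n + 2 *: (P l n * ('X * (P l n)^`()))); last first.
  by rewrite scaler_nat; ring.
rewrite linearD /= functionalZ [X in 2 * X]top; last first.
  by rewrite (leq_trans (size_polyMleq _ _)) // size_polyX ltnS size_derivP.
rewrite coefXM.
have -> : (if n == 0 then 0 else (P l n)^`()`_n.-1) = n%:R.
  by case: n => [//|n] /=; rewrite coef_deriv coefP.
rewrite -/(h n l) => E; apply: (mulIf (h_neq0 n l)).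
have E1 : (rho n l - l) * h n l = - (beta * M1 l (P l n * P l n)).
  by rewrite rhoBl divfK.
have E2 : l * a n l * h n l = l * L l ('X * (P l n * P l n)).
  by rewrite -mulrA /a divfK.
by rewrite E2 /kappa; move: E E1; lra.
Qed.

(** Index shift: [r n] and [b n] link the degrees n and n + 1, and accompany [rho n.+1] in the final
    system. *)
Let r n l := alpha * M0 l (P l n * P l n.+1) / h n l.
Let b n l := h n.+1 l / h n l.

Let rh n l : r n l * h n l = alpha * M0 l (P l n * P l n.+1).
Proof. by rewrite divfK. Qed.

(** Integration by parts with p = P_n P_(n+1): of the derivative only P_n P_(n+1)' survives, with
    top coefficient n + 1, and the term in [l] is 0. *)
Let M1_r n l :
  beta * M1 l (P l n * P l n.+1) = - (r n l + n.+1%:R) * h n l.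
Proof.
have := parts l (P l n * P l n.+1).
rewrite derivM linearD /= [_^`() * _]mulrC low; last first.
  by rewrite (leq_trans (size_derivP _ _)).
rewrite top ?size_derivP // coef_deriv coefP.
rewrite [L l (P l n * P l n.+1)]L_orth ?neq_ltn ?ltnSn // -rh.
lra.
Qed.

Let rho_prod n l : b n l * rho n.+1 l * rho n l = r n l * (r n l - alpha).
Proof.
apply: pole_prod_normalized; rewrite ?h_neq0 //.
exact: (functional_pole_prod (P_monic l) (P_size l) (@L_orth l) (@M0L l)).
Qed.

(** The product formula at the pole 1, where [rhoBl] and [M1_r] translate [M1] into [rho - l] and
    [r + n + 1]. *)
Let rhoBl_prod n l : b n l * (rho n.+1 l - l) * (rho n l - l) =
  (r n l + n.+1%:R) * (r n l + n.+1%:R + beta).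
Proof.
have -> : r n l + n.+1%:R = - (beta * M1 l (P l n * P l n.+1) / h n l).
  by rewrite M1_r mulfK // opprK.
rewrite !rhoBl !mulNr; set u := beta * _ / h n l; set u1 := _ / h n.+1 l.
set m := _ / h n l.
rewrite [LHS](_ : _ = b n l * u1 * m); last by ring.
rewrite [RHS](_ : _ = u * (u - beta)); last by ring.
apply: pole_prod_normalized; rewrite ?h_neq0 //.
exact: (functional_pole_prod (P_monic l) (P_size l) (@L_orth l) (@M1L l)).
Qed.

(** * Dependence on the parameter *)

Let is_derive_JM l (w : {poly R}) (p q : R -> {poly R}) (dp dq : {poly R}) s t :
  (forall y, (size (p y) <= s)%N) -> (forall y, (size (q y) <= t)%N) ->
  is_derive_coef l p dp -> is_derive_coef l q dq ->
  is_derive l 1 (fun y => mul_functional (J y) w (p y * q y))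
    (mul_functional (J l) w (dp * q l + p l * dq)
     - mul_functional (J l) w ('X * (p l * q l))).
Proof.
move=> sp sq lp lq; rewrite /mul_functional [w * ('X * _)]mulrCA.
have lw := is_derive_coefM (is_derive_coef_cst l w) (is_derive_coefM lp lq).
rewrite mul0r add0r in lw.
apply: (is_derive_functional dJ (N := size w + (s + t))) lw => y.
rewrite (leq_trans (size_polyMleq _ _)) // (leq_trans (leq_pred _)) // leq_add2l.
rewrite (leq_trans (size_polyMleq _ _)) // (leq_trans (leq_pred _)) //.
exact: leq_add.
Qed.

(** Orthogonality forces the Gram-Schmidt formula, which expresses P_n through x^n and the lower
    P_k; differentiability follows by strong induction. *)
Let P_derivable n l :
  exists2 dp : {poly R}, (size dp <= n)%N & is_derive_coef l (fun y => P y n) dp.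
Proof.
elim/ltn_ind: n => n IH.
have /choice[d dP] : forall k : 'I_n, exists dp, is_derive_coef l (fun y => P y k) dp.
  by move=> k; have [dp _] := IH k (ltn_ord k); exists dp.
have PE y : P y n = 'X^n - \sum_(k < n) (L y ('X^n * P y k) / h k y) *: P y k.
  apply/eqP; rewrite eq_sym subr_eq addrC -subr_eq; apply/eqP.
  have sX : (size ('X^n - P y n)%R <= n)%N.
    have := @size_sub_monic_basis _ _ (P_monic y) (P_size y) n 'X^n.
    by rewrite coefXn eqxx scale1r; apply; rewrite size_polyXn.
  rewrite (orth_expansion (P_monic y) (P_size y) (@L_orth y) (@L_neq0 y) sX).
  apply: eq_bigr => k _; congr (_ / _ *: _).
  by rewrite mulrBl linearB /= low ?subr0 // P_size.
have [dp dpE] : exists dp, is_derive_coef l (fun y => P y n) dp.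
  under [X in exists dp, is_derive_coef _ X _]funext do rewrite PE.
  have dc (k : 'I_n) : exists dc, is_derive l 1 (fun y => L y ('X^n * P y k) / h k y) dc.
    pose w := 'X * (1 - 'X) : {poly R}.
    have sX (y : R) : (size ('X^n : {poly R}) <= n.+1)%N by rewrite size_polyXn.
    have sP (y : R) : (size (P y k) <= k.+1)%N by rewrite P_size.
    have dn := is_derive_JM w sX sP (is_derive_coef_cst l 'X^n) (dP k).
    have dd := is_derive_JM w sP sP (dP k) (dP k).
    eexists; exact: is_derive1_div (h_neq0 k l) dn dd.
  move/choice: dc => [dc dcE].
  eexists; apply: is_derive_coefB (is_derive_coef_cst _ _) _.
  by apply: is_derive_coef_sum => k; exact: is_derive_coefZ (dcE k) (dP k).
exists dp => //.
(* From degree n on the coefficients are the constants 1, 0, 0, ... *)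
apply: (@size_is_derive_coef _ _ _ _ _ (fun i => (i == n)%:R)) dpE => y i.
rewrite leq_eqVlt => /predU1P[<-|ni]; first by rewrite eqxx coefP.
by rewrite nth_default ?P_size // gtn_eqF.
Qed.

(** Differentiate L(P_n P_k) = 0: the weight contributes a factor - x, and the derivative of P_k has
    degree too low to contribute. *)
Let orth_derive n k l dp : (k < n)%N -> is_derive_coef l (fun y => P y n) dp ->
  L l (dp * P l k) = L l (P l n * ('X * P l k)).
Proof.
move=> kn dpE; have [dq sdq dqE] := P_derivable k l.
have sP (j : nat) (y : R) : (size (P y j) <= j.+1)%N by rewrite P_size.
have D := is_derive_JM ('X * (1 - 'X)) (sP n) (sP k) dpE dqE.
have D0 : is_derive l 1 (fun y => L y (P y n * P y k)) 0.
  under [X in is_derive _ _ X _]funext do rewrite L_orth ?gtn_eqF //.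
  exact: is_derive_cst.
have := is_derive1_unique D D0; rewrite -/(L l _) -[mul_functional _ _ _]/(L l _).
rewrite linearD /= [L l (P l n * dq)]low ?(leq_trans sdq) ?(ltnW kn) // addr0.
by move/eqP; rewrite subr_eq0 => /eqP ->; rewrite mulrCA.
Qed.

(** By [orth_derive] the derivative pairs with P_k as P_(n+1) does with x P_k, which is nonzero for
    k = n only. *)
Let derive_P_succ n l dp : is_derive_coef l (fun y => P y n.+1) dp ->
  (size dp <= n.+1)%N -> dp = b n l *: P l n.
Proof.
move=> dpE sdp; apply/eqP; rewrite -subr_eq0; apply/eqP; apply: (@P_eq0 l n.+1).
  rewrite (leq_trans (size_polyD _ _)) // geq_max sdp size_polyN.
  by rewrite (leq_trans (size_scale_leq _ _)) // P_size.
move=> k kn; rewrite mulrBl linearB /= (orth_derive kn dpE) -scalerAl functionalZ.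
rewrite top; last by rewrite mulrC size_mulX ?P_neq0 // P_size.
rewrite coefXM /=.
move: kn; rewrite ltnS leq_eqVlt => /predU1P[->|kn].
  by rewrite coefP mul1r divfK ?subrr.
by rewrite nth_default ?P_size // L_orth ?gtn_eqF // mulr0 mul0r subr0.
Qed.

(** The three-term recurrence, with the term in P_(n-1) recognized as the derivative of P_n. This
    form involves only P_n and P_(n+1) and covers n = 0. *)
Let derive_P_recurrence n l dp : is_derive_coef l (fun y => P y n) dp ->
  (size dp <= n)%N -> dp = ('X - (a n l)%:P) * P l n - P l n.+1.
Proof.
move=> dpE sdp; apply/eqP; rewrite -subr_eq0; apply/eqP; apply: (@P_eq0 l n.+1).
  apply/leq_sizeP => j; rewrite leq_eqVlt => /predU1P[<-|nj].
    rewrite !coefB mulrBl coefB coefXM coefCM /= !coefP nth_default ?(leqW sdp) //.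
    by rewrite nth_default ?P_size // mulr0 subr0 subrr subr0.
  rewrite !coefB mulrBl coefB coefXM coefCM nth_default; last first.
    by rewrite (leq_trans sdp) // ltnW // ltnW.
  rewrite (gtn_eqF (ltn_trans _ nj)) // [(P l n)`_j.-1]nth_default; last first.
    by rewrite P_size; case: j nj.
  by rewrite [(P l n)`_j]nth_default ?[(P l n.+1)`_j]nth_default ?P_size ?(ltnW nj) //
    mulr0 !subr0.
move=> k; rewrite ltnS leq_eqVlt => /predU1P[->|kn].
  rewrite !mulrBl !linearB /= [dp * _]mulrC low // L_orth ?gtn_eqF //.
  rewrite -mulrA mul_polyC -scalerAl functionalZ -/(h n l) /a divfK //.
  by rewrite opprK !oppr0 add0r addr0 addNr.
rewrite !mulrBl !linearB /= (orth_derive kn dpE) mul_polyC -scalerAl functionalZ.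
rewrite [L l (P l n * P l k)]L_orth ?gtn_eqF //.
rewrite [L l (P l n.+1 * P l k)]L_orth ?gtn_eqF // ?(leqW kn) //.
by rewrite mulr0 !oppr0 !addr0 mulrCA -mulrA subrr.
Qed.

Let sizeP n (y : R) : (size (P y n) <= n.+1)%N. Proof. by rewrite P_size. Qed.

Let M0X l p : M0 l ('X * p) = L l p. Proof. by rewrite -M0L subr0. Qed.

Let h_derive n l : is_derive l 1 (h n) (- (a n l * h n l)).
Proof.
have [dp sdp dpE] := P_derivable n l.
apply: is_derive_eq (is_derive_JM _ (sizeP n) (sizeP n) dpE dpE) _.
rewrite -/(L l _) -[mul_functional _ _ (_ + _)]/(L l _).
rewrite linearD /= [dp * _]mulrC low // add0r add0r.
by rewrite /a divfK.
Qed.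

(** The factor - x from the weight cancels the pole and leaves [- alpha]; the derivative of [h]
    produces [a * rho]. *)
Let rho_derive n l dp : is_derive_coef l (fun y => P y n) dp ->
  is_derive l 1 (rho n)
    (2 * (alpha * M0 l (P l n * dp) / h n l) - alpha + a n l * rho n l).
Proof.
move=> dpE.
have dM := is_derive_JM (1 - 'X) (sizeP n) (sizeP n) dpE dpE.
have da := is_derive1_mul (is_derive_cst alpha l 1) dM.
apply: is_derive_eq (is_derive1_div (h_neq0 n l) da (h_derive n l)) _.
rewrite /= -[mul_functional _ _ ('X * _)]/(M0 l _) M0X -/(h n l).
rewrite -[mul_functional _ _ (_ + _)]/(M0 l _) -[mul_functional _ _ _]/(M0 l _).
rewrite [dp * _]mulrC -mulr2n -scaler_nat functionalZ /rho.
rewrite -[mul_functional _ _ (P l n * dp)]/(M0 l (P l n * dp)).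
have := h_neq0 n l; move: (h n l) (M0 l _) (M0 l _) (a n l) => H u v w H0.
by field.
Qed.

(** Using a different formula for each of the two derivatives keeps everything in P_n and P_(n+1);
    the terms in [a] cancel against the derivative of [h]. *)
Let r_derive n l :
  is_derive l 1 (r n) (b n l * (rho n l - rho n.+1 l)).
Proof.
have [dp sdp dpE] := P_derivable n l.
have [dq sdq dqE] := P_derivable n.+1 l.
have dM := is_derive_JM (1 - 'X) (sizeP n) (sizeP n.+1) dpE dqE.
have da := is_derive1_mul (is_derive_cst alpha l 1) dM.
apply: is_derive_eq (is_derive1_div (h_neq0 n l) da (h_derive n l)) _.
rewrite /= -[mul_functional _ _ ('X * _)]/(M0 l _) M0X L_orth ?ltn_eqF //.
rewrite -[mul_functional _ _ (_ + _)]/(M0 l _) -[mul_functional _ _ _]/(M0 l _).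
rewrite (derive_P_succ dqE sdq) (derive_P_recurrence dpE sdp).
have -> : (('X - (a n l)%:P) * P l n - P l n.+1) * P l n.+1 + P l n * (b n l *: P l n)
    = 'X * (P l n * P l n.+1) - a n l *: (P l n * P l n.+1) - P l n.+1 * P l n.+1
      + b n l *: (P l n * P l n).
  by rewrite -!mul_polyC; ring.
rewrite functionalD !functionalB !functionalZ M0X L_orth ?ltn_eqF //.
rewrite /rho /b.
have := h_neq0 n l; have := h_neq0 n.+1 l.
move: (h n l) (h n.+1 l) (M0 l (P l n * P l n)) (M0 l (P l n * P l n.+1))
  (M0 l (P l n.+1 * P l n.+1)) (a n l) => H H' u v w c H0 H'0.
by field; rewrite H0 H'0.
Qed.

(** The last equation is the derivative of [r0] after eliminating b and the neighbouring rho,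
    cleared of denominators so as to make sense at l = 0. *)
Lemma ladder_system n (rho0 : R -> R) :
  (forall l, rho0 l = alpha * J l ((1 - 'X) * (P l n * P l n))
                      / J l ('X * (1 - 'X) * (P l n * P l n))) ->
  0 < alpha -> 0 < beta ->
  exists a0 r0 r1 : R -> R, forall l,
    [/\ 0 < rho0 l /\ 0 < rho0 l - l,
        l * a0 l = 2 * n%:R + 1 + alpha + beta + l - rho0 l,
        is_derive l 1 rho0 (2 * r0 l - alpha + a0 l * rho0 l),
        is_derive l 1 r0 (r1 l) &
        l * (rho0 l - l) * rho0 l * r1 l =
          l * (rho0 l - l) * (r0 l * (r0 l - alpha))
          + rho0 l * (rho0 l * ((2 * n%:R + alpha + beta) * r0 l + n%:R * (n%:R + beta))
                      + l * (r0 l * (r0 l - alpha)))].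
Proof.
move=> rho0E alpha_gt0 beta_gt0.
have -> : rho0 = rho n by apply/funext => l; rewrite rho0E.
move=> {rho0 rho0E}.
have pos l : 0 < rho n l /\ 0 < rho n l - l.
  split; first by rewrite divr_gt0 ?mulr_gt0 ?M0_gt0.
  by rewrite rhoBl divr_gt0 ?oppr_gt0 ?pmulr_rlt0 ?M1_lt0.
exists (a n); case: n pos => [|n] pos.
  (* With no polynomial below P_0, [r0] is taken to be 0; every term of the last equation then
     contains a factor r or n. *)
  exists (fun=> 0), (fun=> 0) => l; split; rewrite ?rho_a //.
  - have [dp sdp dpE] := P_derivable 0 l.
    apply: is_derive_eq (rho_derive dpE) _.
    move: sdp; rewrite leqn0 size_poly_eq0 => /eqP ->.
    by rewrite mulr0 linear0 mulr0 mul0r.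
  - exact: is_derive_cst.
  - by rewrite !(mulr0, mul0r, addr0).
exists (r n), (fun l => b n l * (rho n l - rho n.+1 l)) => l; split.
- exact: pos.
- exact: rho_a.
- have [dp sdp dpE] := P_derivable n.+1 l.
  apply: is_derive_eq (rho_derive dpE) _; congr (2 * _ - _ + _).
  rewrite (derive_P_succ dpE sdp) -scalerAr functionalZ mulrC [P l n.+1 * _]mulrC.
  by rewrite /r /b; field; rewrite !h_neq0.
- exact: r_derive.
- have E1 := rho_prod n l; have E2 := rhoBl_prod n l.
  (* The difference of the two product relations is linear in [r]; after this substitution both
     sides are multiples of [b]. *)
  have {}E2 : (2 * n.+1%:R + alpha + beta) * r n l + n.+1%:R * (n.+1%:R + beta) =
      b n l * (rho n.+1 l - l) * (rho n l - l) - r n l * (r n l - alpha).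
    by rewrite E2; ring.
  by rewrite E2 -E1; ring.
Qed.

End Ladder.

(** * Improper integrals and the fundamental theorem of calculus *)

Section ImproperFTC.
Variable R : realType.
Local Notation mu := (@lebesgue_measure R).
Implicit Types (f F : R -> R) (a b x df M : R).

Lemma is_derive1_continuous f x df : is_derive x 1 f df -> {for x, continuous f}.
Proof.
by move=> fx; apply/differentiable_continuous/derivable1_diffP; exact: ex_derive.
Qed.

Lemma continuous_itvoo_measurable f a b : {in `]a, b[, continuous f} ->
  measurable_fun `[a, b] f.
Proof.
move=> cf; apply/measurable_fun_itv_bndo_bndcP/measurable_fun_itv_obnd_cbndP.
apply: open_continuous_measurable_fun; first exact: interval_open.
by move=> x; rewrite inE; exact: cf.
Qed.

(** Here [f] may blow up at the endpoints. The indefinite integral of [f] has the same derivative as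
    [F] inside, so by the mean value theorem they differ by a constant. *)
Lemma integrable_FTC2 f F a b : a < b ->
  mu.-integrable `[a, b] (EFin \o f) ->
  {in `]a, b[, continuous f} ->
  {within `[a, b], continuous F} ->
  (forall x, x \in `]a, b[ -> is_derive x 1 F (f x)) ->
  (\int[mu]_(x in `[a, b]) f x)%R = F b - F a.
Proof.
move=> ab intf cf cF dF.
pose G x := parameterized_integral mu a x f.
have dG x : x \in `]a, b[ -> is_derive x 1 G (f x).
  move=> xab; have := xab; rewrite in_itv /= => /andP[ax xb].
  have [dGx G'x] := continuous_FTC1_closed xb intf ax (cf _ xab).
  by apply: DeriveDef => //; rewrite -derive1E.
have cG := parameterized_integral_continuous (ltW ab) intf.
have dFG x : x \in `]a, b[ -> is_derive x 1 (fun y => F y - G y) 0.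
  move=> xab; rewrite -(subrr (f x)); apply: is_deriveB; [exact: dF|exact: dG].
have cFG : {within `[a, b], continuous (fun y => F y - G y)}.
  by move=> x; apply: cvgB; [exact: cF|exact: cG].
have [c _] := MVT ab dFG cFG; rewrite mul0r.
rewrite {2}/G /parameterized_integral set_itv1 Rintegral_set1 subr0.
rewrite /G /parameterized_integral => E; move: E; lra.
Qed.

(** On compact subintervals the integral is a difference of values of [F], at most 2 M; monotone
    convergence passes to the whole interval. *)
Lemma integrable_ge0_derivative f F a b M : a < b ->
  {in `]a, b[, continuous f} ->
  (forall x, x \in `]a, b[ -> 0 <= f x) ->
  (forall x, x \in `]a, b[ -> is_derive x 1 F (f x)) ->
  (forall x, x \in `]a, b[ -> `|F x| <= M) ->
  mu.-integrable `[a, b] (EFin \o f).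
Proof.
move=> ab cf f0 dF FM.
have mf := continuous_itvoo_measurable cf.
(* The shift by 3 gives e_i <= (b - a)/3, so that each subinterval is nondegenerate. *)
pose e i := (b - a) / (i%:R + 3).
have e_gt0 i : 0 < e i by rewrite divr_gt0 ?subr_gt0 // ltr_wpDl.
have e_le i : e i <= (b - a) / 3.
  by rewrite ler_pM2l ?subr_gt0 // lef_pV2 ?posrE ?ltr_wpDl // lerDr.
pose S i := [set` `[a + e i, b - e i]].
have Soo i : S i `<=` `]a, b[.
  move=> x; rewrite /S /= !in_itv /= => /andP[ax xb]; have := e_gt0 i.
  by apply: contraTT; lra.
have ndS : nondecreasing_seq S.
  move=> i j ij; apply/subsetPset => x; rewrite /S /= !in_itv /= => /andP[ax xb].
  have : e j <= e i.
    by rewrite ler_pM2l ?subr_gt0 // lef_pV2 ?posrE ?ltr_wpDl // lerD2r ler_nat.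
  by move=> eij; rewrite (le_trans _ ax) ?lerD2l // (le_trans xb) // lerD2l lerN2.
have SU : \bigcup_i S i = `]a, b[%classic.
  apply/seteqP; split => [x [i _] /Soo //|x /=]; rewrite in_itv /= => /andP[ax xb].
  pose m := Num.min (x - a) (b - x).
  have m_gt0 : 0 < m by rewrite lt_min !subr_gt0 ax xb.
  exists (Num.truncn ((b - a) / m)).+1 => //.
  have em : e (Num.truncn ((b - a) / m)).+1 <= m.
    rewrite /e ler_pdivrMr ?ltr_wpDl // mulrC -ler_pdivrMr //.
    by rewrite ltW // (lt_le_trans (truncnS_gt _)) // lerDl.
  rewrite /S /= in_itv /=; move: em; rewrite le_min => /andP[]; lra.
have mS i : measurable (S i) by exact: measurable_itv.
have mfS i : measurable_fun (S i) (EFin \o f).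
  apply/measurable_EFinP; apply: measurable_funS mf => //.
  by apply: subset_trans (Soo i) _; exact: subset_itv_oo_cc.
have f0S i x : S i x -> (0 <= (EFin \o f) x)%E.
  by move=> /Soo xab; rewrite lee_fin f0.
have intS i : (\int[mu]_(x in S i) (EFin \o f) x <= (2 * M)%:E)%E.
  have eab : a + e i < b - e i by have := e_le i; move: ab; lra.
  have Sab x : S i x -> x \in `]a, b[ by exact: Soo.
  have lS : S i (a + e i) by rewrite /S /= in_itv /= lexx ltW.
  have rS : S i (b - e i) by rewrite /S /= in_itv /= lexx ltW.
  rewrite (@continuous_FTC2 _ f F) //.
  - rewrite lee_fin; have := FM _ (Sab _ lS); have := FM _ (Sab _ rS).
    by rewrite !ler_norml; lra.
  - by apply/continuous_in_subspaceT => x /[1!inE] /Sab; exact: cf.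
  - split.
    + by move=> x /subset_itv_oo_cc /Sab /dF dx; exact: ex_derive.
    + by apply: cvg_at_right_filter; exact: (is_derive1_continuous (dF _ (Sab _ lS))).
    + by apply: cvg_at_left_filter; exact: (is_derive1_continuous (dF _ (Sab _ rS))).
  - by move=> x /subset_itv_oo_cc /Sab /dF dx; rewrite derive1E derive_val.
have int_oo : (\int[mu]_(x in `]a, b[) (f x)%:E <= (2 * M)%:E)%E.
  have cvgS : (\int[mu]_(x in S i) (EFin \o f) x @[i --> \oo] -->
      \int[mu]_(x in \bigcup_i S i) (EFin \o f) x)%E.
    by apply: ge0_nondecreasing_set_cvg_integral => // i; exact: mS.
  by rewrite SU in cvgS; apply: cvge_le cvgS; exact: nearW.
have mfoo : measurable_fun `]a, b[ f.
  by apply: measurable_funS mf => //; exact: subset_itv_oo_cc.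
apply/integrableP; split; first exact/measurable_EFinP.
rewrite integral_itv_bndoo; last exact/measurable_EFinP/measurableT_comp.
apply: le_lt_trans (ltry (2 * M)); apply: le_trans int_oo.
by rewrite le_eqVlt; apply/orP; left; apply/eqP/eq_integral => x;
  rewrite inE => /= /f0 fx; rewrite ger0_norm.
Qed.

End ImproperFTC.

(** * The Jacobi functional *)

Lemma cvg_onem_at_left1 (R : realType) : (fun x : R => 1 - x) @ 1^'- --> 0^'+.
Proof.
move=> A [e /= e0 Ae]; exists e => //= x xe x1; apply: Ae => /=; last lra.
by rewrite sub0r normrN.
Qed.

Lemma norm_horner_le (R : realDomainType) (p : {poly R}) x :
  0 <= x <= 1 -> `|p.[x]| <= \sum_(i < size p) `|p`_i|.
Proof.
move=> /andP[x0 x1]; rewrite horner_coef (le_trans (ler_norm_sum _ _ _)) //.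
apply: ler_sum => i _; rewrite normrM ler_piMr // normrX ger0_norm //.
exact: exprn_ile1.
Qed.

Lemma is_derive_powR_onem (R : realType) (a x : R) : x < 1 ->
  is_derive x 1 (fun y => (1 - y) `^ a) (- (a * (1 - x) `^ (a - 1))).
Proof.
move=> x1; have x1' : 0 < 1 - x by rewrite subr_gt0.
have dg := is_deriveB (is_derive_cst (1 : R) x 1) (is_derive_id x 1).
have D : is_derive x 1 (fun y => (1 - y) `^ a) (a * (1 - x) `^ (a - 1) * (0 - 1)).
  exact: (@is_derive1_comp R (fun y => y `^ a) (cst 1 - id) x _ _ (is_derive1_powR a x1') dg).
by apply: is_derive_eq D _; rewrite sub0r mulrN1.
Qed.

Lemma is_derive_expR_lin (R : realType) (l x : R) :
  is_derive x 1 (fun y => expR (- (l * y))) (- l * expR (- (l * x))).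
Proof.
have dg := is_deriveN (is_deriveZ l (is_derive_id x 1)).
have D : is_derive x 1 (fun y => expR (- (l * y))) (expR (- (l * x)) * - (l * 1)).
  exact: (@is_derive1_comp R expR (- (l \*: id)) x _ _ (is_derive_expR (- (l * x))) dg).
by apply: is_derive_eq D _; rewrite mulr1 mulrC.
Qed.

Lemma powR_le1 (R : realType) (a x : R) : 0 < a -> 0 <= x <= 1 -> x `^ a <= 1.
Proof.
move=> a0 /andP[x0 x1]; have <- : 1 `^ a = 1 by rewrite powR1.
by rewrite ge0_ler_powR ?nnegrE // ltW.
Qed.

(** Serves to show that the zero set of a nonzero polynomial is Lebesgue negligible. *)
Lemma poly_roots_seq (F : fieldType) (p : {poly F}) : p != 0 ->
  exists s : seq F, forall x, root p x -> x \in s.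
Proof.
have [n] := ubnP (size p); elim: n p => // n IH p /ltnSE pn p0.
have [[a pa]|noroot] := pselect (exists a, root p a); last first.
  by exists [::] => x px; case: noroot; exists x.
have /factor_theorem[q pE] := pa.
have q0 : q != 0 by apply: contraNneq p0 => q0; rewrite pE q0 mul0r.
have [|s qs] := IH q _ q0.
  apply: leq_trans pn; rewrite pE size_Mmonic ?monicXsubC // size_XsubC addn2.
  exact: leqnn.
exists (a :: s) => x; rewrite pE rootM root_XsubC inE orbC => /orP[->//|/qs ->].
by rewrite orbT.
Qed.

Section JacobiFunctional.
Variables (R : realType) (alpha beta : R).
Hypotheses (alpha_gt0 : 0 < alpha) (beta_gt0 : 0 < beta).
Local Notation mu := (@lebesgue_measure R).
Local Notation w := (weight alpha beta).
Implicit Types (l x : R) (p q : {poly R}).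

(* The common integrand of all the integrals involved: dividing the weight by
   [x (1 - x)] makes each of them the integral of a polynomial against it. *)
Definition jacobi_kernel l x := x^-1 * (1 - x)^-1 * w l x.

Lemma jacobi_kernelE l x : 0 < x < 1 ->
  jacobi_kernel l x = x `^ (alpha - 1) * (1 - x) `^ (beta - 1) * expR (- (l * x)).
Proof.
move=> /andP[x0 x1]; have x1' : 0 < 1 - x by rewrite subr_gt0.
rewrite /jacobi_kernel /weight -(mulr_powRB1 (ltW x0) alpha_gt0).
rewrite -(mulr_powRB1 (ltW x1') beta_gt0).
by field; rewrite !gt_eqF.
Qed.

Lemma jacobi_kernel0 l : jacobi_kernel l 0 = 0.
Proof. by rewrite /jacobi_kernel invr0 !mul0r. Qed.

Lemma jacobi_kernel1 l : jacobi_kernel l 1 = 0.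
Proof. by rewrite /jacobi_kernel subrr invr0 mulr0 mul0r. Qed.

(* The convention [0^-1 = 0] makes this hold at the endpoints too, where the
   weight vanishes. *)
Lemma weight_kernel l x : w l x = x * (1 - x) * jacobi_kernel l x.
Proof.
rewrite /jacobi_kernel; have [->|x0] := eqVneq x 0.
  by rewrite /weight powR0 ?gt_eqF // !mul0r.
have [x1|x1] := eqVneq (1 - x) 0; last by field; rewrite x0 x1.
by rewrite /weight x1 powR0 ?gt_eqF // !(mulr0, mul0r).
Qed.

Lemma jacobi_kernel_ge0 l x : 0 <= x <= 1 -> 0 <= jacobi_kernel l x.
Proof.
move=> /andP[x0 x1]; rewrite /jacobi_kernel /weight.
by rewrite !mulr_ge0 ?powR_ge0 ?expR_ge0 // invr_ge0 ?subr_ge0.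
Qed.

Lemma jacobi_kernel_gt0 l x : 0 < x < 1 -> 0 < jacobi_kernel l x.
Proof.
move=> /andP[x0 x1]; rewrite /jacobi_kernel /weight.
by rewrite !mulr_gt0 ?powR_gt0 ?expR_gt0 ?invr_gt0 ?subr_gt0.
Qed.

Lemma is_derive_weight l x : 0 < x < 1 ->
  is_derive x 1 (w l) ((alpha * (1 - x) - beta * x - l * (x * (1 - x))) * jacobi_kernel l x).
Proof.
move=> /andP[x0 x1]; have x1' : 0 < 1 - x by rewrite subr_gt0.
have dx := is_derive1_powR alpha x0.
have dy := is_derive_powR_onem beta x1.
have de := is_derive_expR_lin l x.
apply: is_derive_eq (is_derive1_mul (is_derive1_mul dx dy) de) _.
rewrite jacobi_kernelE ?x0 // -(mulr_powRB1 (ltW x0) alpha_gt0).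
rewrite -(mulr_powRB1 (ltW x1') beta_gt0).
ring.
Qed.

Lemma jacobi_kernel_continuous l : {in `]0, 1[, continuous (jacobi_kernel l)}.
Proof.
move=> x; rewrite in_itv /= => x01; have /andP[x0 x1] := x01.
apply: cvgM; last exact: is_derive1_continuous (is_derive_weight l x01).
apply: cvgM; first by apply: cvgV; [rewrite gt_eqF | exact: cvg_id].
apply: cvgV; first by rewrite gt_eqF // subr_gt0.
by apply: cvgB; [exact: cvg_cst | exact: cvg_id].
Qed.

(** Even when a < 1, the primitive x^a / a is bounded by 1/a on the unit interval. *)
Let integrable_powR (a : R) : 0 < a ->
  mu.-integrable `[0, 1] (EFin \o (fun x => x `^ (a - 1))).
Proof.
move=> a0.
apply: (@integrable_ge0_derivative _ _ (fun x => x `^ a / a) _ _ a^-1) => // x;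
  rewrite in_itv /= => /andP[x0 x1].
- exact: is_derive1_continuous (is_derive1_powR _ x0).
- exact: powR_ge0.
- have D := is_derive1_mul (is_derive1_powR a x0) (is_derive_cst a^-1 x 1).
  by apply: is_derive_eq D _; rewrite mulr0 addr0 /cst mulrAC mulfV ?gt_eqF // mul1r.
- rewrite normrM (ger0_norm (powR_ge0 _ _)) gtr0_norm ?invr_gt0 //.
  by rewrite ler_piMl ?invr_ge0 ?(ltW a0) // powR_le1 // !ltW.
Qed.

Let integrable_powR_onem (a : R) : 0 < a ->
  mu.-integrable `[0, 1] (EFin \o (fun x => (1 - x) `^ (a - 1))).
Proof.
move=> a0.
apply: (@integrable_ge0_derivative _ _ (fun x => (1 - x) `^ a * - a^-1) _ _ a^-1) => // x;
  rewrite in_itv /= => /andP[x0 x1].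
- exact: is_derive1_continuous (is_derive_powR_onem _ x1).
- exact: powR_ge0.
- have D := is_derive1_mul (is_derive_powR_onem a x1) (is_derive_cst (- a^-1) x 1).
  by apply: is_derive_eq D _; rewrite mulr0 addr0 /cst; field; rewrite gt_eqF.
- rewrite normrM (ger0_norm (powR_ge0 _ _)) normrN gtr0_norm ?invr_gt0 //.
  rewrite ler_piMl ?invr_ge0 ?(ltW a0) // powR_le1 // subr_ge0 (ltW x1) /=.
  by rewrite gerBl ltW.
Qed.

(** Reduces integrability to l = 0 and provides a domination that is locally uniform in [l]. *)
Lemma jacobi_kernel_le l x : 0 <= x <= 1 ->
  jacobi_kernel l x <= expR `|l| * jacobi_kernel 0 x.
Proof.
move=> /[dup] x01 /andP[x0 x1].
have -> : jacobi_kernel l x = expR (- (l * x)) * jacobi_kernel 0 x.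
  by rewrite /jacobi_kernel /weight mul0r oppr0 expR0; ring.
rewrite ler_wpM2r ?jacobi_kernel_ge0 // ler_expR (le_trans (ler_norm _)) //.
by rewrite normrN normrM ler_piMr // ger0_norm.
Qed.

Lemma integrable_kernel l : mu.-integrable `[0, 1] (EFin \o jacobi_kernel l).
Proof.
have mk (m : R) : measurable_fun `[(0 : R), 1] (EFin \o jacobi_kernel m).
  by apply/measurable_EFinP; exact: continuous_itvoo_measurable (@jacobi_kernel_continuous m).
suff int0 : mu.-integrable `[0, 1] (EFin \o jacobi_kernel 0).
  have : mu.-integrable `[0, 1] (fun x => (expR `|l|)%:E * (EFin \o jacobi_kernel 0) x)%E.
    exact: integrableZl.
  apply: le_integrable => //; first exact: mk.
  move=> x /=; rewrite in_itv /= => x01; rewrite lee_fin.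
  rewrite ger0_norm ?jacobi_kernel_ge0 // ger0_norm ?jacobi_kernel_le //.
  by rewrite mulr_ge0 ?expR_ge0 ?jacobi_kernel_ge0.
have : mu.-integrable `[0, 1] (fun x =>
    (x `^ (alpha - 1))%R%:E + ((1 - x) `^ (beta - 1))%R%:E)%E.
  by apply: integrableD => //; [exact: integrable_powR | exact: integrable_powR_onem].
apply: le_integrable => //; first exact: mk.
move=> x /=; rewrite in_itv /= => x01; rewrite lee_fin.
rewrite ger0_norm ?jacobi_kernel_ge0 // ger0_norm ?addr_ge0 ?powR_ge0 //.
have /andP[] := x01; rewrite le_eqVlt => /predU1P[<- _|x0].
  by rewrite jacobi_kernel0 addr_ge0 ?powR_ge0.
rewrite le_eqVlt => /predU1P[->|x1]; first by rewrite jacobi_kernel1 addr_ge0 ?powR_ge0.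
(* [1 = x + (1 - x)] splits the kernel into two summands with one singularity each *)
have x1' : 0 < 1 - x by rewrite subr_gt0.
rewrite jacobi_kernelE ?x0 // mul0r oppr0 expR0 mulr1.
set u := x `^ _; set v := (1 - x) `^ _.
rewrite [leLHS](_ : _ = u * ((1 - x) * v) + (x * u) * v); last by ring.
rewrite /u /v (mulr_powRB1 (ltW x0) alpha_gt0) (mulr_powRB1 (ltW x1') beta_gt0).
apply: lerD.
  by rewrite ler_piMr ?powR_ge0 // powR_le1 // (ltW x1') gerBl ltW.
by rewrite ler_piMl ?powR_ge0 // powR_le1 // !ltW.
Qed.

Lemma integrable_poly_kernel l p :
  mu.-integrable `[0, 1] (EFin \o (fun x => p.[x] * jacobi_kernel l x)).
Proof.
pose C := \sum_(i < size p) `|p`_i|.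
have : mu.-integrable `[0, 1] (fun x => C%:E * (EFin \o jacobi_kernel l) x)%E.
  by apply: integrableZl => //; exact: integrable_kernel.
apply: le_integrable => //.
  apply/measurable_EFinP; apply: continuous_itvoo_measurable => x x01.
  apply: cvgM; first exact: continuous_horner.
  exact: jacobi_kernel_continuous.
move=> x /=; rewrite in_itv /= => x01; rewrite lee_fin !normrM.
rewrite ler_wpM2r // (le_trans (norm_horner_le _ x01)) //.
by rewrite ler_norm.
Qed.

Definition jacobi_integral l p := int01 (fun x => p.[x] * jacobi_kernel l x).

Fact jacobi_integral_is_scalar l : scalar (jacobi_integral l).
Proof.
move=> a p q; have ip := integrable_poly_kernel l p.
have iq := integrable_poly_kernel l q.
have iap : mu.-integrable `[0, 1] (EFin \o (fun x => a * (p.[x] * jacobi_kernel l x))).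
  rewrite (_ : (fun x => _) = fun x => (a *: p).[x] * jacobi_kernel l x).
    exact: integrable_poly_kernel.
  by apply/funext => x; rewrite hornerZ mulrA.
rewrite /jacobi_integral /int01 -RintegralZl // -RintegralD //.
by apply: eq_Rintegral => x _; rewrite hornerD hornerZ; ring.
Qed.

Definition jacobi_functional l : {scalar {poly R}} :=
  HB.pack (jacobi_integral l)
    (GRing.isLinear.Build R {poly R} R^o *%R (jacobi_integral l)
      (jacobi_integral_is_scalar l)).

Local Notation J := jacobi_functional.

(** Differentiation under the integral sign for m in []l - 1, l + 1[], where |m| <= |l| + 1 gives a
    dominating function free of m. *)
Lemma is_derive_jacobi_functional l p :
  is_derive l 1 (fun m => J m p) (- J l ('X * p)).
Proof.
pose f m x := p.[x] * jacobi_kernel m x.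
have df (m x : R) : is_derive m 1 (f ^~ x) ((- ('X * p)).[x] * jacobi_kernel m x).
  pose c := p.[x] * (x^-1 * (1 - x)^-1 * (x `^ alpha * (1 - x) `^ beta)).
  have dg := is_deriveN (is_derive1_mul (is_derive_id m 1) (is_derive_cst x m 1)).
  have de : is_derive m 1 (fun k => expR (- (k * x))) (expR (- (m * x)) * - (1 * x + m * 0)).
    exact: (@is_derive1_comp R expR (- (fun y : R => y * x)) m _ _
      (is_derive_expR (- (m * x))) dg).
  have -> : f ^~ x = fun k => c * expR (- (k * x)).
    by apply/funext => k; rewrite /f /jacobi_kernel /weight /c; ring.
  apply: is_derive_eq (is_derive1_mul (is_derive_cst c m 1) de) _.
  by rewrite /jacobi_kernel /weight /c /cst !hornerE /=; ring.
pose C := \sum_(i < size ('X * p)%R) `|('X * p)`_i|.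
pose K := C * expR (`|l| + 1).
have C_ge0 : 0 <= C by exact: sumr_ge0.
(* The absolute value makes the bound nonnegative on the whole line, as [G_ge0] asks. *)
have intG : mu.-integrable `[0, 1] (EFin \o (fun x => `|K * jacobi_kernel 0 x|)).
  have : mu.-integrable `[0, 1] (fun x => K%:E * (EFin \o jacobi_kernel 0) x)%E.
    by apply: integrableZl => //; exact: integrable_kernel.
  exact: integrable_norm.
have Il : [set` `]l - 1, l + 1[] l by rewrite /= in_itv /=; lra.
have intf : forall m : R, [set` `]l - 1, l + 1[] m -> mu.-integrable `[0, 1] (EFin \o f m).
  by move=> m _; exact: integrable_poly_kernel.
have derf : forall m x : R, [set` `]l - 1, l + 1[] m -> [set` `[0, 1]] x ->
    derivable (f ^~ x) m 1.
  by move=> m x _ _; exact: ex_derive.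
have G_ge0 : forall x : R, 0 <= `|K * jacobi_kernel 0 x| by [].
have f1E (m x : R) : partial1of2 f m x = (- ('X * p)).[x] * jacobi_kernel m x.
  by rewrite partial1of2E derive_val.
have G_ub : forall m x : R, [set` `]l - 1, l + 1[] m -> [set` `[0, 1]] x ->
    `|partial1of2 f m x| <= `|K * jacobi_kernel 0 x|.
  move=> m x; rewrite /= !in_itv /= => ml x01.
  rewrite f1E hornerN mulNr normrN normrM (ger0_norm (jacobi_kernel_ge0 _ x01)).
  rewrite [leRHS]ger0_norm; last first.
    by apply: mulr_ge0; [exact: mulr_ge0 (expR_ge0 _) | exact: jacobi_kernel_ge0].
  rewrite /K -mulrA ler_pM ?jacobi_kernel_ge0 ?norm_horner_le //.
  rewrite (le_trans (jacobi_kernel_le _ x01)) // ler_wpM2r ?jacobi_kernel_ge0 // ler_expR.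
  by rewrite -(subrK l m) (le_trans (ler_normD _ _)) // addrC lerD2l ler_norml; lra.
have der := derivable_under_integral _ Il intf derf G_ge0 intG G_ub.
have derE := differentiation_under_integral _ Il intf derf G_ge0 intG G_ub.
apply: DeriveDef; first by apply: der; exact: measurable_itv.
rewrite -derive1E derE; last exact: measurable_itv.
transitivity (J l (- ('X * p))); last exact: linearN.
by apply: eq_Rintegral => x _; exact: f1E.
Qed.

(** If the integral were 0, the integrand would vanish almost everywhere, and [0, 1] would be
    covered by a null set, the roots of [p] and the endpoints. *)
Lemma jacobi_functional_gt0 l p : p != 0 ->
  (forall x, 0 <= x <= 1 -> 0 <= p.[x]) -> 0 < J l p.
Proof.
move=> p0 p_ge0; have ip := integrable_poly_kernel l p.
have g_ge0 x : 0 <= x <= 1 -> 0 <= p.[x] * jacobi_kernel l x.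
  by move=> x01; rewrite mulr_ge0 ?p_ge0 ?jacobi_kernel_ge0.
rewrite lt_neqAle; apply/andP; split; last first.
  by apply: Rintegral_ge0 => x /=; rewrite in_itv; exact: g_ge0.
apply/eqP => J0.
pose g x := p.[x] * jacobi_kernel l x.
have int0 : (\int[mu]_(x in `[0%R, 1%R]) `|(EFin \o g) x| = 0)%E.
  transitivity (\int[mu]_(x in `[0%R, 1%R]) (EFin \o g) x)%E.
    apply: eq_integral => x; rewrite inE /= in_itv /= => x01.
    by rewrite ger0_norm ?g_ge0.
  rewrite -[LHS]fineK; first by rewrite -[fine _]/(J l p) -J0.
  by apply: integrable_fin_num.
have mg : measurable_fun `[(0 : R), 1] (EFin \o g).
  by have /integrableP[] := ip.
have [N [mN muN gN]] : ae_eq mu [set` `[(0 : R), 1]] (EFin \o g) (cst 0%E).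
  by apply/ae_eq_integral_abs.
have [s ps] := poly_roots_seq p0.
pose S := [set` (0 : R) :: 1 :: s].
have S0 : mu S = 0%E.
  by apply: countable_lebesgue_measure0; apply: finite_set_countable; exact: finite_seq.
have sub : [set` `[(0 : R), 1]] `<=` N `|` S.
  move=> x x01; have [Nx|Nx] := pselect (N x); [by left|right].
  have {Nx}gx0 : g x = 0.
    by apply: contrapT => gx; apply/Nx/gN => H; apply/gx/EFin_inj/H.
  move: x01; rewrite /S /= in_itv /= !inE => /andP[].
  rewrite le_eqVlt => /predU1P[<- _|x0]; first by rewrite eqxx.
  rewrite le_eqVlt => /predU1P[->|x1]; first by rewrite eqxx orbT.
  rewrite ps ?orbT // /root; move/eqP: gx0; rewrite mulf_eq0 => /orP[//|].
  by rewrite gt_eqF // jacobi_kernel_gt0 // x0.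
have mS : measurable S.
  apply: countable_measurable; first exact: measurable_set1.
  by apply: finite_set_countable; exact: finite_seq.
have : (mu [set` `[(0 : R)%R, 1%R]] <= mu N + mu S)%E.
  apply: le_trans (measureU2 _ mN mS).
  by apply: le_measure; rewrite ?inE //; exact: measurableU.
rewrite muN S0 adde0 lebesgue_measure_itv /= lte_fin ltr01 oppr0 adde0 lee_fin.
by rewrite ler10.
Qed.

Lemma cvg_weight_at0 l : w l x @[x --> 0^'+] --> w l 0.
Proof.
have -> : w l 0 = 0 * (1 - 0) `^ beta * expR (- (l * 0)).
  by rewrite weight_kernel // !mul0r.
have cexp := is_derive1_continuous (is_derive_expR_lin l 0).
have cb := is_derive1_continuous (is_derive_powR_onem beta (ltr01 : (0 : R) < 1)).
apply: cvgM; last exact: cvg_at_right_filter cexp.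
by apply: cvgM; [exact: powR_cvg0 | exact: cvg_at_right_filter cb].
Qed.

Lemma cvg_weight_at1 l : w l x @[x --> 1^'-] --> w l 1.
Proof.
have -> : w l 1 = 1 `^ alpha * 0 * expR (- (l * 1)).
  by rewrite weight_kernel // subrr mulr0 !mul0r mulr0 mul0r.
have cexp := is_derive1_continuous (is_derive_expR_lin l 1).
have ca := is_derive1_continuous (is_derive1_powR alpha (ltr01 : (0 : R) < 1)).
apply: cvgM; last exact: cvg_at_left_filter cexp.
apply: cvgM; first exact: cvg_at_left_filter ca.
exact: (cvg_comp _ _ (@cvg_onem_at_left1 R) (powR_cvg0 beta_gt0)).
Qed.

(** The combined polynomial [q] times the kernel is the derivative of p w, which vanishes at both
    ends because [alpha] and [beta] are positive. *)
Lemma jacobi_functional_parts l p :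
  J l ('X * (1 - 'X) * p^`()) + alpha * J l ((1 - 'X) * p)
  - beta * J l ('X * p) - l * J l ('X * (1 - 'X) * p) = 0.
Proof.
rewrite -!functionalZ -functionalD -!functionalB.
set q := (X in J l X).
have ab : (0 : R) < 1 by [].
have E := @integrable_FTC2 R (fun x => q.[x] * jacobi_kernel l x)
  (fun x => p.[x] * w l x) 0 1 ab (integrable_poly_kernel l q).
rewrite [LHS]E.
- by rewrite !weight_kernel // jacobi_kernel1 jacobi_kernel0 !mulr0 subrr.
- by move=> x x01; apply: cvgM; [exact: continuous_horner | exact: jacobi_kernel_continuous].
- apply/continuous_within_itvP => //; split.
  + move=> x; rewrite in_itv /= => x01; apply: cvgM; first exact: continuous_horner.
    exact: is_derive1_continuous (is_derive_weight _ x01).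
  + apply: cvgM; first by apply: cvg_at_right_filter; exact: continuous_horner.
    exact: cvg_weight_at0.
  + apply: cvgM; first by apply: cvg_at_left_filter; exact: continuous_horner.
    exact: cvg_weight_at1.
- move=> x; rewrite in_itv /= => x01.
  have D := is_derive1_mul (is_derive_poly p x) (is_derive_weight l x01).
  apply: is_derive_eq D _; rewrite weight_kernel // /q !hornerE /=; ring.
Qed.

End JacobiFunctional.

(** * Painleve V *)

(** Here [D] is l rho', and the equation is taken at the point - l. Successive substitution leaves a
    rational identity in [l], [rho], [r] and the parameters. *)
Lemma painleve5_algebra (F : realFieldType) (al be n l rho rho1 r r1 D D1 Y Y1 Y2 : F) :
  l != 0 -> rho != 0 -> rho - l != 0 ->
  D = 2 * l * r - al * l + (2 * n + 1 + al + be + l - rho) * rho ->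
  l * rho1 = D ->
  D1 = 2 * r + 2 * l * r1 - al + (1 - rho1) * rho
       + (2 * n + 1 + al + be + l - rho) * rho1 ->
  l * (rho - l) * rho * r1 =
    l * (rho - l) * (r * (r - al))
    + rho * (rho * ((2 * n + al + be) * r + n * (n + be)) + l * (r * (r - al))) ->
  Y = 1 - l / rho -> Y1 = rho^-1 - D / rho ^+ 2 ->
  Y2 = (rho1 + D1) / rho ^+ 2 - 2 * D * rho1 / rho ^+ 3 ->
  Y2 = (3 * Y - 1) / (2 * Y * (Y - 1)) * Y1 ^+ 2 - Y1 / - l
       + (Y - 1) ^+ 2 / (- l) ^+ 2 * (al ^+ 2 / 2 * Y + - (be ^+ 2 / 2) / Y)
       + (2 * n + 1 + al + be) * Y / - l
       + - (1 / 2) * Y * (Y + 1) / (Y - 1).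
Proof.
move=> l0 rho0 rhol0 DE lrho1 D1E r1E -> -> ->.
have -> : rho1 = D / l by rewrite -lrho1 mulrC mulKf.
rewrite D1E.
have -> : rho1 = D / l by rewrite -lrho1 mulrC mulKf.
have -> : r1 = (l * (rho - l) * (r * (r - al))
    + rho * (rho * ((2 * n + al + be) * r + n * (n + be)) + l * (r * (r - al))))
    / (l * (rho - l) * rho).
  by rewrite -r1E mulrC mulKf // !mulf_neq0.
rewrite DE; field.
(* The denominators come down to [l], [rho] and [rho - l], as Y = (rho - l)/rho and Y - 1 = -
   l/rho. *)
by rewrite rho0 l0 rhol0 mulN1r addrAC subrr sub0r oppr_eq0 l0.
Qed.

Theorem theorem3p1 (R : realType) (alpha beta : R) (n : nat)
    (P : R -> nat -> {poly R}) (Y : R -> R)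
    (alpha_gt0 : 0 < alpha) (beta_gt0 : 0 < beta)
    (P_orth : forall l : R, monic_orthogonal (weight alpha beta l) (P l))
    (Y_def : forall l : R, Y (- l) = 1 - l / R_coef alpha beta l (P l n)) :
  (forall l : R, l != 0 ->
     painleve5_at (alpha ^+ 2 / 2) (- (beta ^+ 2 / 2))
       (2 * n%:R + 1 + alpha + beta) (- (1 / 2)) Y l) /\
  Y 0 = 1 /\
  is_derive (0 : R) (1 : R) Y (1 / (2 * n%:R + 1 + alpha + beta)).
Proof.
pose J := jacobi_functional alpha_gt0 beta_gt0.
pose rho l := R_coef alpha beta l (P l n).
have intw l (p : {poly R}) :
    int01 (fun x => p.[x] * weight alpha beta l x) = J l ('X * (1 - 'X) * p).
  congr int01; apply/funext => x; rewrite weight_kernel // !hornerE /=; ring.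
have rhoE l : rho l = alpha * J l ((1 - 'X) * (P l n * P l n))
                      / J l ('X * (1 - 'X) * (P l n * P l n)).
  rewrite /rho /R_coef /sq_norm -intw mulrAC; congr (_ * _ / _).
    congr int01; apply/funext => x.
    (* At x = 0 both integrands are 0 by the convention on inverses. *)
    have [->|x0] := eqVneq x 0; first by rewrite invr0 mulr0 mul0r jacobi_kernel0 mulr0.
    rewrite weight_kernel //; move: (jacobi_kernel _ _ _ _) => k; rewrite !hornerE /=.
    by field.
  by congr int01; apply/funext => x; rewrite hornerM expr2.
have P_monic l k : P l k \is monic by have [/(_ k)[]] := P_orth l.
have P_size l k : size (P l k) = k.+1 by have [/(_ k)[]] := P_orth l.
have P_ortho l j k : j != k -> J l ('X * (1 - 'X) * (P l j * P l k)) = 0.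
  have [_ /(_ j k) + jk] := P_orth l; move=> /(_ jk) <-; rewrite -intw.
  by congr int01; apply/funext => x; rewrite hornerM.
have [a [r [r1 sys]]] := ladder_system
  (is_derive_jacobi_functional alpha_gt0 beta_gt0)
  (jacobi_functional_gt0 alpha_gt0 beta_gt0)
  (jacobi_functional_parts alpha_gt0 beta_gt0)
  P_monic P_size P_ortho rhoE alpha_gt0 beta_gt0.
pose kappa := 2 * n%:R + 1 + alpha + beta.
pose rho1 l := 2 * r l - alpha + a l * rho l.
(* [D] is l rho' with l a replaced by kappa + l - rho, so that differentiating it does not require a
   derivative of [a]. *)
pose D l := 2 * l * r l - alpha * l + (kappa + l - rho l) * rho l.
have rho_neq0 l : rho l != 0 by have [[rho_gt0 _] _ _ _ _] := sys l; rewrite gt_eqF.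
have drho (l : R) : is_derive l 1 rho (rho1 l) by have [] := sys l.
have dr (l : R) : is_derive l 1 r (r1 l) by have [] := sys l.
have lrho1 (l : R) : l * rho1 l = D l.
  have [_ la _ _ _] := sys l.
  by rewrite /rho1 mulrDr mulrA la /D /kappa; ring.
pose D1 l := 2 * r l + 2 * l * r1 l - alpha + (1 - rho1 l) * rho l
             + (kappa + l - rho l) * rho1 l.
have dD (l : R) : is_derive l 1 D (D1 l).
  have d0 := is_derive1_mul (is_derive_cst (2 : R) l 1) (is_derive_id l 1).
  have d1 := is_derive1_mul d0 (dr l).
  have d2 := is_derive1_mul (is_derive_cst alpha l 1) (is_derive_id l 1).
  have d3 := is_deriveB (is_deriveD (is_derive_cst kappa l 1) (is_derive_id l 1)) (drho l).
  have d4 := is_deriveD (is_deriveB d1 d2) (is_derive1_mul d3 (drho l)).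
  apply: is_derive_eq d4 _.
  by rewrite -[(_ + id - rho) l]/(kappa + l - rho l) /cst /D1 /=; ring.
(* [Y1 l] and [Y2 l] are the first two derivatives of [Y] at - l, chain rule signs included. *)
pose Y1 l := (rho l)^-1 - D l / rho l ^+ 2.
pose Y2 l := (rho1 l + D1 l) / rho l ^+ 2 - 2 * D l * rho1 l / rho l ^+ 3.
have YE t : Y t = 1 - (- t) / rho (- t) by rewrite -[in LHS](opprK t) Y_def.
have dN (t : R) : is_derive t 1 (fun t : R => - t) (-1 : R) by exact: is_deriveNid.
have dY (t : R) : is_derive t 1 Y (Y1 (- t)).
  have d1 := is_deriveB (is_derive_cst (1 : R) (- t) 1)
    (is_derive1_div (rho_neq0 (- t)) (is_derive_id (- t) 1) (drho (- t))).
  have d2 := @is_derive1_comp R _ (fun t : R => - t) t _ _ d1 (dN t).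
  rewrite (_ : Y = (fun l => 1 - l / rho l) \o (fun t : R => - t)); last first.
    by apply/funext => x; rewrite YE.
  apply: is_derive_eq d2 _; rewrite /Y1 -lrho1 /=; ring.
have Y1E : derive1 Y = fun t => Y1 (- t).
  by apply/funext => t; rewrite derive1E derive_val.
have dY1 (t : R) : is_derive t 1 (derive1 Y) (Y2 (- t)).
  have d1 := is_deriveB
    (is_derive1_div (rho_neq0 (- t)) (is_derive_cst (1 : R) (- t) 1) (drho (- t)))
    (@is_derive1_div R D (fun l => rho l * rho l) _ _ _
      (mulf_neq0 (rho_neq0 (- t)) (rho_neq0 (- t))) (dD (- t))
      (is_derive1_mul (drho (- t)) (drho (- t)))).
  have d2 := @is_derive1_comp R _ (fun t : R => - t) t _ _ d1 (dN t).
  rewrite Y1E (_ : (fun t => Y1 (- t)) =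
    (fun l => 1 / rho l - D l / (rho l * rho l)) \o (fun t : R => - t)); last first.
    by apply/funext => x; rewrite /Y1 /= div1r expr2.
  apply: is_derive_eq d2 _; rewrite /Y2 /=.
  by field; exact: rho_neq0.
split; [|split].
- move=> t t0; rewrite -(opprK t); have : - t != 0 by rewrite oppr_eq0.
  move: (- t) => l l0 {t t0}.
  have [[rho_gt0 rhol_gt0] _ _ _ r1E] := sys l.
  have rhol0 : rho l - l != 0 by rewrite gt_eqF.
  split.
  + rewrite oppr_eq0 Y_def -/(rho l); split=> //.
      by rewrite -(divff (rho_neq0 l)) -mulrBl mulf_neq0 ?invr_neq0.
    by rewrite eq_sym -subr_eq0 subKr mulf_neq0 ?invr_neq0.
  + exact: ex_derive.
  + exact: ex_derive.
  + rewrite derive1E derive_val Y1E /= opprK.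
    by apply: (@painleve5_algebra R alpha beta n%:R l (rho l) (rho1 l) (r l) (r1 l)
      (D l) (D1 l) _ _ _ l0 (rho_neq0 l) rhol0 _ (lrho1 l) _ r1E (Y_def l)).
- by rewrite YE oppr0 mul0r subr0.
- apply: is_derive_eq (dY 0) _; rewrite oppr0 /Y1 -lrho1 mul0r mul0r subr0 div1r.
  (* At l = 0 the relation for l a reduces to rho(0) = kappa. *)
  have [_ la _ _ _] := sys 0; move: la; rewrite mul0r => la.
  by congr (_^-1); move: la; lra.
Qed.
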